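(* Let $a,b,c$ be the constant parameters of Halphen's second equation, let $x_1,x_2,x_3$ be functions of $t$, and put $$P(x)=(x-x_1)(x-x_2)(x-x_3),\qquad Q(x)=x^2+a(x_1-x_2)^2+b(x_2-x_3)^2+c(x_3-x_1)^2.$$ Let $\mu$ and $c_1,c_2,c_3$ be constants with $c_1+c_2+c_3=0$, let $S$ be any traceless constant $2\times 2$ matrix, and assume that the scalar function $\nu=\nu(x,t)$ satisfies $$\frac{\partial \nu}{\partial x}=-\frac{x+x_1+x_2+x_3}{P}\,\mu .$$ Consider the $2\times 2$ linear system $$\frac{\partial Y}{\partial x}=\left(\frac{\mu}{P}+\sum_{j=1}^3\frac{c_j S}{x-x_j}\right)Y,\qquad \frac{\partial Y}{\partial t}=\left(\nu+\sum_{j=1}^3 c_jx_j S\right)Y-Q(x)\frac{\partial Y}{\partial x}.$$ Then the compatibility condition of these two equations gives Halphen's second equation $$x_j'=Q(x_j)=x_j^2+a(x_1-x_2)^2+b(x_2-x_3)^2+c(x_3-x_1)^2,\qquad j=1,2,3,$$ where $'=d/dt$.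
   Context: The scalar terms $\mu/P$ and $\nu$ in the linear system stand for these scalars times the $2\times2$ identity matrix. $P$ and $Q$ depend on $t$ through $x_1,x_2,x_3$. Writing the two equations as $\partial_xY=AY$ and $\partial_tY=BY$, with $A=\frac{\mu}{P}+\sum_{j=1}^3\frac{c_jS}{x-x_j}$ and $B=\nu+\sum_{j=1}^3c_jx_jS-Q(x)A$, the compatibility (integrability) condition is $\partial_tA-\partial_xB+AB-BA=0$.
   Formalization: That compatibility gives Halphen's equation is proved when μ≠0, or when S≠0, all c_j≠0 and x_1,x_2,x_3 never all coincide; without such a condition (e.g. μ=0, S=0, ν=0) compatibility holds for arbitrary x_j and the claim fails. *)

(* Defs.v *)
From mathcomp Require Import all_boot all_order all_algebra.
From mathcomp Require Import complex.
From mathcomp Require Import all_classical all_reals all_analysis.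

Set Implicit Arguments.
Unset Strict Implicit.
Unset Printing Implicit Defensive.

Import Order.TTheory GRing.Theory Num.Theory.
Import numFieldNormedType.Exports.
Local Open Scope classical_set_scope.
Local Open Scope ring_scope.

(* The ascription to numFieldType lets the normed-field topology of
   MathComp-Analysis apply, so that derivatives below are complex ones. *)
Definition Cplx (R : realType) : numFieldType := R[i].

Section Halphen.
Variable K : numFieldType.
Implicit Types (X : 'I_3 -> K -> K) (k : 'I_3 -> K) (S : 'M[K]_2).
Implicit Types (nu : K -> K -> K) (x t : K).

(* The functions x_1, x_2, x_3 are X 0, X 1, X 2, and the constants c_1, c_2,
   c_3 are k 0, k 1, k 2, where the indices are the elements of 'I_3. *)

Definition Ppol X x t : K := \prod_(j < 3) (x - X j t).

Definition Qpol (a b c : K) X x t : K :=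
  x ^+ 2 + a * (X 0 t - X 1 t) ^+ 2 + b * (X 1 t - X 2 t) ^+ 2
         + c * (X 2 t - X 0 t) ^+ 2.

Definition lax_A (mu : K) k S X x t : 'M[K]_2 :=
  (mu / Ppol X x t)%:M + \sum_(j < 3) (k j / (x - X j t)) *: S.

(* Coefficient of Y in the t-equation once d_x Y has been replaced by A Y. *)
Definition lax_B (a b c mu : K) k S nu X x t : 'M[K]_2 :=
  (nu x t)%:M + \sum_(j < 3) (k j * X j t) *: S
  - Qpol a b c X x t *: lax_A mu k S X x t.

(* Integrability of d_x Y = A Y, d_t Y = B Y at (x, t): d_t A - d_x B + [A, B] = 0.
   derive1 is total; it is the true derivative where A (in t) and B (in x) are
   differentiable, as is the case for lax_A and lax_B when the X j are
   differentiable in t, nu is differentiable in x, and x is none of the X j t. *)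
Definition compatible_at (A B : K -> K -> 'M[K]_2) x t : Prop :=
  (fun s => A x s)^`()%classic t - (fun z => B z t)^`()%classic x
    + A x t *m B x t - B x t *m A x t = 0.

Definition halphen2_at (a b c : K) X t : Prop :=
  forall j : 'I_3, is_derive t 1 (X j) (Qpol a b c X (X j t) t).

End Halphen.

(* Main.v *)
(* Put delta_j = x_j' - Q(x_j).  Both coefficient matrices are combinations of 1
   and S, so they commute, and partial fractions together with c_1+c_2+c_3 = 0
   reduce compatibility to
     (mu / P) * sum_j delta_j / (x - x_j) = 0  and
     sum_j c_j delta_j / (x - x_j)^2 . S = 0,
   which the trace separates.  Where the x_j are distinct the poles are
   independent, whence delta_j = 0.
   At a time t0 where some x_j collide, merge the indices having the same
   position and the same velocity at t0; delta is constant on each class.  A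
   pole alone in its class is simple at all times near t0 other than t0, so there
   x_j' = Q(x_j), and this passes to t0 because a derivative having a limit at t0
   takes that value at t0 (L'Hopital on real parts along a real line: no
   holomorphic regularity is needed).  At most one class is not a singleton, and
   the identity at t0 then forces its delta to vanish as well. *)

Require Import Defs.
From mathcomp Require Import all_boot all_order all_algebra.
From mathcomp Require Import complex.
From mathcomp Require Import all_classical all_reals all_analysis.
From mathcomp Require Import ring.
Import Order.TTheory GRing.Theory Num.Theory.
Import numFieldNormedType.Exports.
Local Open Scope classical_set_scope.
Local Open Scope ring_scope.

(** * Sums, products and case analysis over three indices *)

Lemma big_I3 (T : Type) (idx : T) (op : Monoid.law idx) (F : 'I_3 -> T) :
  \big[op/idx]_(j < 3) F j = op (op (F 0) (F 1)) (F 2).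
Proof.
rewrite !big_ord_recl big_ord0 Monoid.mulm1 Monoid.mulmA.
by congr (op (op _ (F _)) (F _)); apply: val_inj.
Qed.

Lemma ord3P (P : 'I_3 -> Prop) : P 0 -> P 1 -> P 2 -> forall j, P j.
Proof.
move=> P0 P1 P2 [[|[|[|//]]] lt_j3].
- by rewrite (_ : Ordinal _ = 0) //; apply: val_inj.
- by rewrite (_ : Ordinal _ = 1) //; apply: val_inj.
- by rewrite (_ : Ordinal _ = 2) //; apply: val_inj.
Qed.

(** * Derivatives of scalar multiples of a fixed vector and of inverses *)

Section Derivatives.
Set Implicit Arguments.
Unset Strict Implicit.
Variables (K : numFieldType) (V : normedModType K).
Implicit Types (f : K -> K) (x l : K).

(** The fixed vector factors out of the difference quotient. With [v] equal to the identity or [S],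
    differentiating the Lax matrices becomes a scalar computation. *)
Lemma is_derive_scalel f x l (v : V) :
  is_derive x 1 f l -> is_derive x 1 (fun y => f y *: v) (l *: v).
Proof.
case=> df <-.
have cvg_quot : (fun h => h^-1 *: (((fun y => f y *: v) \o shift x) (h *: 1) -
    f x *: v)) @ 0^' --> 'D_1 f x *: v.
  rewrite [X in X @ _](_ : _ = (fun h =>
      (h^-1 *: ((f \o shift x) (h *: 1) - f x)) *: v)).
    exact: cvgZr_tmp.
  by apply/funext => h /=; rewrite -scalerBl scalerA.
apply: DeriveDef; first by apply/cvg_ex; eexists; exact: cvg_quot.
exact: cvg_lim cvg_quot.
Qed.

Lemma is_derive_inv f x l : f x != 0 -> is_derive x 1 f l ->
  is_derive x 1 (fun y => (f y)^-1) (- (f x) ^- 2 * l).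
Proof.
move=> fx0 [df <-]; apply: DeriveDef; first exact: derivableV.
by rewrite deriveV.
Qed.

End Derivatives.

(** * The compatibility condition in partial-fraction form *)

Section Compatibility.
Set Implicit Arguments.
Unset Strict Implicit.
Variable K : numFieldType.
Implicit Types (X : 'I_3 -> K -> K) (k D : 'I_3 -> K) (S : 'M[K]_2).

(** Collecting the coefficients of the identity and of [S] turns the later matrix identities into
    pairs of scalar ones. *)
Lemma lax_AE (mu : K) k S X x t : lax_A mu k S X x t =
  (mu / ((x - X 0 t) * (x - X 1 t) * (x - X 2 t))) *: 1%:M +
  (k 0 / (x - X 0 t) + k 1 / (x - X 1 t) + k 2 / (x - X 2 t)) *: S.
Proof.
by rewrite /lax_A /Ppol !big_I3 !scalerDl scalemx1.
Qed.

Lemma lax_BE (a b c mu : K) k S nu X x t : lax_B a b c mu k S nu X x t =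
  (nu x t - Qpol a b c X x t *
     (mu / ((x - X 0 t) * (x - X 1 t) * (x - X 2 t)))) *: 1%:M +
  (k 0 * X 0 t + k 1 * X 1 t + k 2 * X 2 t - Qpol a b c X x t *
     (k 0 / (x - X 0 t) + k 1 / (x - X 1 t) + k 2 / (x - X 2 t))) *: S.
Proof.
rewrite /lax_B lax_AE big_I3 /= -!scalerDl -[(nu x t)%:M]scalemx1.
rewrite scalerDr !scalerA.
by rewrite !scalerBl opprD addrACA.
Qed.

Lemma is_derive_lax_A (mu : K) k S X x t D :
  (forall j, x != X j t) -> (forall j, is_derive t 1 (X j) (D j)) ->
  is_derive t 1 (fun s => lax_A mu k S X x s)
    ((mu / Ppol X x t * \sum_(j < 3) D j / (x - X j t)) *: 1%:M +
     (\sum_(j < 3) k j * D j / (x - X j t) ^+ 2) *: S).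
Proof.
move=> xX dX.
have ne0 j : x - X j t != 0 by rewrite subr_eq0.
have dxX j : is_derive t 1 (fun s => (x - X j s)^-1) (D j / (x - X j t) ^+ 2).
  have d : is_derive t 1 (fun s => x - X j s) (- D j).
    by apply: is_derive_eq; rewrite sub0r.
  apply: (is_derive_eq (is_derive_inv _ d)) => //.
  by rewrite mulrNN mulrC.
(* Writing 1/P as a product of three inverses lets the product rule use [dxX] factor by factor. *)
rewrite (_ : (fun s => lax_A mu k S X x s) =
  (fun s => (mu * ((x - X 0 s)^-1 * (x - X 1 s)^-1 *
   (x - X 2 s)^-1)) *: 1%:M) + (fun s => (k 0 / (x - X 0 s) +
   k 1 / (x - X 1 s) + k 2 / (x - X 2 s)) *: S)); last first.
  by apply/funext => s; rewrite lax_AE !invfM.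
apply: is_deriveD; apply: is_derive_scalel.
- have d := is_deriveZ mu (is_deriveM (is_deriveM (dxX 0) (dxX 1)) (dxX 2)).
  apply: (is_derive_eq d); rewrite /Ppol !big_I3 /= /GRing.scale /=.
  rewrite -![(_ * _ : K -> K) _]/(_ * _).
  by field; rewrite !ne0.
- have d := is_deriveD (is_deriveD (is_deriveZ (k 0) (dxX 0))
    (is_deriveZ (k 1) (dxX 1))) (is_deriveZ (k 2) (dxX 2)).
  apply: (is_derive_eq d); rewrite !big_I3 /GRing.scale /=.
  by field; rewrite !ne0.
Qed.

Lemma is_derive_lax_B (a b c mu n : K) k S nu X x t :
  (forall j, x != X j t) -> is_derive x 1 (fun z => nu z t) n ->
  is_derive x 1 (fun z => lax_B a b c mu k S nu X z t)
    ((n - mu / Ppol X x t * (2 * x - Qpol a b c X x t *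
        \sum_(j < 3) (x - X j t)^-1)) *: 1%:M +
     (Qpol a b c X x t * (\sum_(j < 3) k j / (x - X j t) ^+ 2) -
        2 * x * \sum_(j < 3) k j / (x - X j t)) *: S).
Proof.
move=> xX dnu.
have ne0 j : x - X j t != 0 by rewrite subr_eq0.
have dxX j : is_derive x 1 (fun z => (z - X j t)^-1) (- (x - X j t) ^- 2).
  have d : is_derive x 1 (fun z => z - X j t) 1.
    by apply: is_derive_eq; rewrite subr0.
  by apply: (is_derive_eq (is_derive_inv _ d)) => //; rewrite mulr1.
have dQ : is_derive x 1 (fun z => Qpol a b c X z t) (2 * x).
  pose q := a * (X 0 t - X 1 t) ^+ 2 + b * (X 1 t - X 2 t) ^+ 2 +
    c * (X 2 t - X 0 t) ^+ 2.
  rewrite (_ : (fun z => Qpol a b c X z t) = (fun z => z ^+ 2 + q)); last first.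
    by apply/funext => z; rewrite /Qpol /q !addrA.
  by apply: is_derive_eq; rewrite addr0 /GRing.scale /=; ring.
rewrite (_ : (fun z => lax_B a b c mu k S nu X z t) =
  (fun z => (nu z t - Qpol a b c X z t *
    (mu * ((z - X 0 t)^-1 * (z - X 1 t)^-1 * (z - X 2 t)^-1))) *: 1%:M) +
  (fun z => (k 0 * X 0 t + k 1 * X 1 t + k 2 * X 2 t - Qpol a b c X z t *
    (k 0 / (z - X 0 t) + k 1 / (z - X 1 t) + k 2 / (z - X 2 t))) *: S));
  last first.
  by apply/funext => z; rewrite lax_BE !invfM.
apply: is_deriveD; apply: is_derive_scalel.
- have d := is_deriveB dnu (is_deriveM dQ
    (is_deriveZ mu (is_deriveM (is_deriveM (dxX 0) (dxX 1)) (dxX 2)))).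
  apply: (is_derive_eq d); rewrite /Ppol !big_I3 /= /GRing.scale /=.
  rewrite -![(_ * _ : K -> K) _]/(_ * _).
  by field; rewrite !ne0.
- have d := is_deriveB
    (is_derive_cst (k 0 * X 0 t + k 1 * X 1 t + k 2 * X 2 t) x 1)
    (is_deriveM dQ (is_deriveD (is_deriveD (is_deriveZ (k 0) (dxX 0))
    (is_deriveZ (k 1) (dxX 1))) (is_deriveZ (k 2) (dxX 2)))).
  apply: (is_derive_eq d); rewrite !big_I3 /GRing.scale /=.
  rewrite -![(_ + _ : K -> K) _]/(_ + _) /= /GRing.scale /=.
  by field; rewrite !ne0.
Qed.

(** The commutator vanishes. In the rest, Q(x) = Q(x_j) + (x - x_j)(x + x_j) replaces Q(x) by Q(x_j)
    at each pole. The polynomial remainder 3x + x_1 + x_2 + x_3 in the scalar part is cancelled by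
    2x from Q' and by the derivative of [nu]; the remainder in the [S] part is c_1 + c_2 + c_3 =
    0. *)
Lemma compatible_atE (a b c mu : K) k S nu X x t D :
  k 0 + k 1 + k 2 = 0 ->
  (forall j, x != X j t) -> (forall j, is_derive t 1 (X j) (D j)) ->
  is_derive x 1 (fun z => nu z t)
    (- ((x + X 0 t + X 1 t + X 2 t) / Ppol X x t) * mu) ->
  compatible_at (lax_A mu k S X) (lax_B a b c mu k S nu X) x t <->
  (mu / Ppol X x t *
     \sum_(j < 3) (D j - Qpol a b c X (X j t) t) / (x - X j t)) *: 1%:M +
  (\sum_(j < 3) k j * (D j - Qpol a b c X (X j t) t) / (x - X j t) ^+ 2) *: S
  = 0.
Proof.
move=> sum_k xX dX dnu.
have ne0 j : x - X j t != 0 by rewrite subr_eq0.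
rewrite /compatible_at !derive1E.
rewrite (@derive_val _ _ _ _ _ _ _ (is_derive_lax_A mu k S xX dX)).
rewrite (@derive_val _ _ _ _ _ _ _ (is_derive_lax_B a b c mu k S xX dnu)).
have comm : lax_A mu k S X x t *m lax_B a b c mu k S nu X x t =
            lax_B a b c mu k S nu X x t *m lax_A mu k S X x t.
  rewrite lax_AE lax_BE !mulmxDl !mulmxDr -!scalemxAl -!scalemxAr !scalerA.
  rewrite !mulmx1 !mul1mx [LHS]addrACA.
  by congr (_ *: _ + _ *: _ + (_ *: _ + _ *: _)); exact: mulrC.
rewrite comm addrK opprD addrACA -!scalerBl.
(* Eliminating [k 2] builds the zero sum of the c_j into the rational identity left to [field]. *)
have k2 : k 2 = - (k 0 + k 1) by apply/eqP; rewrite -addr_eq0 addrC sum_k.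
set L := (X in X = 0 <-> _); set M := (X in _ <-> X = 0).
suff -> : L = M by [].
rewrite /L /M /Ppol /Qpol !big_I3 /= k2.
by congr (_ *: _ + _ *: _); field; rewrite !ne0.
Qed.

End Compatibility.

(** * Limits of complex derivatives, by restriction to a real line *)

Section ComplexToReal.
Set Implicit Arguments.
Unset Strict Implicit.
Variable R : realType.
Implicit Types (f g : Cplx R -> Cplx R) (t d l z : Cplx R) (s : R).

Lemma ltc_Re (z e : Cplx R) : z < e -> complex.Re z < complex.Re e.
Proof. by rewrite ltcE => /andP[]. Qed.

Lemma normC_Re (z : Cplx R) : `|complex.Re z| <= complex.Re `|z|.
Proof.
rewrite normc_def /= -sqrtr_sqr ler_sqrt ?lerDl ?sqr_ge0 //.
by rewrite addr_ge0 ?sqr_ge0.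
Qed.

Lemma Re_scale s z : complex.Re ((s%:C)%C * z) = s * complex.Re z.
Proof. by case: z => u v /=; rewrite mul0r subr0. Qed.

Lemma continuous_complex_Re : continuous (fun z : Cplx R => complex.Re z : R).
Proof.
move=> z; apply/(@cvgrPdist_lt _ _ _ _ (@nbhs_filter _ z)) => e e0.
have e0C : 0 < (e%:C)%C :> Cplx R by rewrite ltcR.
apply: filterS (nbhsx_ballx z _ e0C) => w zw.
by rewrite -raddfB; apply: le_lt_trans (normC_Re _) (ltc_Re zw).
Qed.

Lemma continuous_real_complex : continuous (fun s : R => (s%:C)%C : Cplx R).
Proof.
move=> s; apply/cvgrPdist_lt => e e0.
(* In the partial order on complex numbers, a positive element is real. *)
have [r r0 ->] : exists2 r : R, 0 < r & e = (r%:C)%C.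
  by move: e0; case: e => r i; rewrite ltcE /= => /andP[/eqP -> ?]; exists r.
apply: filterS (nbhsx_ballx s _ r0) => w sw.
by rewrite -rmorphB normc_def /= expr0n addr0 sqrtr_sqr ltcR.
Qed.

Lemma cvg_dnbhs_real_line t : (t + (s%:C)%C : Cplx R) @[s --> 0^'] --> t^'.
Proof.
have line_cvg : (t + (s%:C)%C : Cplx R) @[s --> (0 : R)] --> t.
  rewrite -[X in _ --> X]addr0 -[X in _ --> _ + X](rmorph0 (real_complex R)).
  by apply: cvgD; [exact: cvg_cst|exact: continuous_real_complex].
move=> P tP.
have near0 : \forall s \near (0 : R), t + (s%:C)%C != t -> P (t + (s%:C)%C).
  exact: (line_cvg _ tP).
apply: filterS near0 => s Ps s0; apply: Ps.
by rewrite -subr_eq0 addrAC subrr add0r (inj_eq (@complexI R)).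
Qed.

Lemma is_derive_Re_line f t s d : is_derive (t + (s%:C)%C : Cplx R) 1 f d ->
  is_derive s 1 (fun r => complex.Re (f (t + (r%:C)%C : Cplx R)))
    (complex.Re d).
Proof.
case=> df <-.
set Q := fun h : Cplx R => h^-1 *: ((f \o shift (t + (s%:C)%C)) (h *: 1) -
  f (t + (s%:C)%C)) in df *.
have cvg_quot : (fun h : R => h^-1 *: (((fun r => complex.Re (f (t + (r%:C)%C)))
    \o shift s) (h *: 1) - complex.Re (f (t + (s%:C)%C)))) @ 0^' -->
    complex.Re ('D_1 f (t + (s%:C)%C)).
  rewrite [X in X @ _](_ : _ = (fun h : R => complex.Re (Q (0 + (h%:C)%C)))).
    apply: continuous_cvg; first exact: continuous_complex_Re.
    exact: (cvg_comp _ _ (@cvg_dnbhs_real_line 0) df).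
  apply/funext => h; rewrite /Q add0r /= /GRing.scale /= !mulr1.
  rewrite -(fmorphV (real_complex R)) Re_scale raddfB.
  congr (h^-1 * (complex.Re (f _) - _)).
  by rewrite rmorphD addrCA.
apply: DeriveDef; first by apply/cvg_ex; eexists; exact: cvg_quot.
exact: cvg_lim cvg_quot.
Qed.

(** Along the real direction, with [F] the increment of Re f from t, the quotient F(s)/s tends to Re
    d by definition of the derivative, and to Re l by L'Hopital's rule on the right of 0. The two
    limits must agree. *)
Lemma derive_Re_limit f g t d l : is_derive t 1 f d ->
  (\forall s \near t^', is_derive (s : Cplx R) 1 f (g s)) ->
  g @ t^' --> l -> complex.Re d = complex.Re l.
Proof.
move=> df dfg gl.
have line0 : t + (0%:C)%C = t :> Cplx R by rewrite rmorph0 addr0.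
pose F (s : R) : R := complex.Re (f (t + (s%:C)%C)) - complex.Re (f t).
have dF (s : R) (e : Cplx R) : is_derive (t + (s%:C)%C : Cplx R) 1 f e ->
    is_derive s 1 F (complex.Re e).
  move=> /is_derive_Re_line dRe; rewrite -[X in is_derive _ _ _ X]subr0.
  exact: is_deriveB.
have dF0 : is_derive (0 : R) 1 F (complex.Re d) by apply: dF; rewrite line0.
have F0 : F 0 = 0 by rewrite /F line0 subrr.
have quot_d : F s / s @[s --> 0^'+] --> complex.Re d.
  apply: cvg_dnbhs_at_right; case: dF0 => dF0 <-.
  rewrite [X in X @ _](_ : _ =
    (fun h => h^-1 *: ((F \o shift 0) (h *: 1) - F 0))) //.
  by apply/funext => s /=; rewrite F0 subr0 addr0 /GRing.scale /= mulr1 mulrC.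
have /(@cvg_dnbhs_real_line t) := dfg.
case=> r /= r0 dfr.
have quot_l : F s / s @[s --> 0^'+] --> complex.Re l.
  apply: (@lhopital_at_right R F (fun s => complex.Re (g (t + (s%:C)%C))) id
    (fun=> 1) _ _ _ r0).
  - move=> s; rewrite in_itv /= => /andP[s0 sr]; apply/dF/dfr.
      by rewrite /= sub0r normrN gtr0_norm.
    by rewrite gt_eqF.
  - apply: cvg_at_right_filter; rewrite -[X in _ --> X]F0.
    by apply/differentiable_continuous/derivable1_diffP; case: dF0.
  - by apply: cvg_at_right_filter; exact: cvg_id.
  - by move=> s _; exact: oner_neq0.
  - apply: cvg_dnbhs_at_right.
    rewrite [X in X @ _](_ : _ = (fun s : R => complex.Re (g (t + (s%:C)%C)))).
      apply: continuous_cvg; first exact: continuous_complex_Re.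
      exact: (cvg_comp _ _ (@cvg_dnbhs_real_line t) gl).
    by apply/funext => s; rewrite divr1.
exact: norm_cvg_unique quot_d quot_l.
Qed.

Lemma derive_limit f g t d l : is_derive t 1 f d ->
  (\forall s \near t^', is_derive (s : Cplx R) 1 f (g s)) ->
  g @ t^' --> l -> d = l.
Proof.
move=> df dfg gl; apply/eqP; rewrite eq_complex; apply/andP; split; apply/eqP.
  exact: derive_Re_limit df dfg gl.
(* Since Re(iz) = -Im z, the real-part result applied to i f compares the imaginary parts. *)
pose i : Cplx R := ('i)%C.
have := @derive_Re_limit (i \*: f) (i \*: g) t (i *: d) (i *: l).
have ReE z : complex.Re (i *: z) = - complex.Im z by rewrite -ReiNIm mulrC.
rewrite !ReE => Re_eq; apply: oppr_inj; apply: Re_eq.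
- by near do apply: is_deriveZ.
- exact: cvgZl_tmp.
Unshelve. all: by end_near. Qed.

End ComplexToReal.

(** * Independence of poles of equal order *)

Section PartialFractions.
Set Implicit Arguments.
Unset Strict Implicit.
Variable K : numFieldType.
Implicit Types (p : {poly K}) (x : K).

Lemma near_root_poly0 p x : (\forall y \near x, root p y) -> p = 0.
Proof.
move=> /nbhs_ballP[e /= e0 pe]; apply/eqP/negPn/negP => p0.
(* These are [size p] distinct roots, one more than the degree allows. The shift by 2 makes every
   denominator exceed 1, so the points lie strictly inside the ball. *)
pose s := [seq x + e / n.+2%:R | n <- iota 0 (size p)].
have s_roots : all (root p) s.
  apply/allP => _ /mapP[n _ ->]; apply: pe.
  rewrite -ball_normE /= opprD addNKr normrN.
  rewrite gtr0_norm ?divr_gt0 // ltr_pdivrMr // ltr_pMr //.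
  by rewrite ltr1n.
have s_uniq : uniq s.
  rewrite map_inj_uniq ?iota_uniq // => m n /addrI.
  move=> /(mulfI (lt0r_neq0 e0)) /invr_inj /eqP.
  by rewrite eqr_nat => /eqP[].
by have := max_poly_roots p0 s_roots s_uniq; rewrite size_map size_iota ltnn.
Qed.

(** Clearing denominators gives a polynomial that vanishes near [x], hence identically. At [z i]
    only the term of index [i] survives, and its cofactor is nonzero because no other node equals
    [z i]; the other nodes may coincide among themselves. *)
Lemma partial_fractions_eq0 (I : finType) (n : nat) (w z : I -> K) x (i : I) :
  (\forall y \near x,
     (forall j, y != z j) /\ \sum_j w j / (y - z j) ^+ n.+1 = 0) ->
  (forall j, j != i -> z j != z i) -> w i = 0.
Proof.
move=> sum0 zi.
pose p := \sum_j (w j)%:P * \prod_(l | l != j) ('X - (z l)%:P) ^+ n.+1.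
have pE y : p.[y] = \sum_j w j * \prod_(l | l != j) (y - z l) ^+ n.+1.
  rewrite horner_sum; apply: eq_bigr => j _; rewrite hornerCM horner_prod.
  by congr (_ * _); apply: eq_bigr => l _; rewrite horner_exp hornerXsubC.
have p0 : p = 0.
  apply: (@near_root_poly0 _ x); apply: filterS sum0 => y [yz sumy].
  rewrite /root pE (_ : \sum_j _ = \prod_l (y - z l) ^+ n.+1 *
    \sum_j w j / (y - z j) ^+ n.+1); first by rewrite sumy mulr0.
  rewrite mulr_sumr; apply: eq_bigr => j _.
  rewrite [X in _ = X * _](bigD1 j) //= [RHS]mulrC [RHS]mulrA.
  by rewrite divfK // expf_neq0 // subr_eq0.
have others0 :
    \sum_(j | j != i) w j * \prod_(l | l != j) (z i - z l) ^+ n.+1 = 0.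
  apply: big1 => j ji; rewrite (bigD1 i) 1?eq_sym //=.
  by rewrite subrr expr0n mul0r mulr0.
have prod0 : \prod_(l | l != i) (z i - z l) ^+ n.+1 != 0.
  apply/prodf_neq0 => l /zi zl.
  by rewrite expf_neq0 // subr_eq0 eq_sym.
have /esym/eqP := pE (z i); rewrite p0 horner0 (bigD1 i) //= others0 addr0.
by rewrite mulf_eq0 (negPf prod0) orbF => /eqP.
Qed.

End PartialFractions.

(** * From vanishing residues to Halphen's equation, collisions included *)

Section CollidingNodes.
Set Implicit Arguments.
Unset Strict Implicit.

(* [e] relates two indices when the corresponding poles have the same position
   and the same velocity. *)
Lemma merged_residues_eq0 (K : fieldType) (w d u : 'I_3 -> K) (e : rel 'I_3) :
  reflexive e -> symmetric e -> transitive e ->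
  (forall i j, e i j -> d i = d j /\ u i = u j) ->
  (forall i, (forall j, j != i -> ~~ e j i) -> d i = 0) ->
  (forall i j, i != j -> w i + w j != 0) ->
  w 0 + w 1 + w 2 != 0 \/ (exists i j, ~~ e i j) ->
  (forall i, u i != 0) ->
  \sum_j w j * d j / u j = 0 ->
  forall i, d i = 0.
Proof.
move=> refl_e sym_e trans_e merged alone wD wsum u0; rewrite big_I3 /= => sum0.
have cancel_pole (v y r : K) : v != 0 -> r != 0 -> v * y / r = 0 -> y = 0.
  by move=> v0 r0 /eqP; rewrite !mulf_eq0 invr_eq0 (negPf v0) (negPf r0) orbF
    => /eqP.
have alone_d i j k : (forall l, l != i -> l = j \/ l = k) ->
    ~~ e j i -> ~~ e k i -> d i = 0.
  by move=> jk ji ki; apply: alone => l /jk[] ->.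
have d0 : ~~ e 1 0 -> ~~ e 2 0 -> d 0 = 0.
  by apply: alone_d; apply: ord3P => //; [left|right].
have d1 : ~~ e 0 1 -> ~~ e 2 1 -> d 1 = 0.
  by apply: alone_d; apply: ord3P => //; [left|right].
have d2 : ~~ e 0 2 -> ~~ e 1 2 -> d 2 = 0.
  by apply: alone_d; apply: ord3P => //; [left|right].
(* Exactly two related pairs would contradict transitivity. A class of two has weight [w i + w j],
   the other index being alone with zero [d]; the class of three has the total weight, or is
   excluded by an unrelated pair. *)
case e01: (e 0 1); case e02: (e 0 2); case e12: (e 1 2).
- have [d01 u01] := merged _ _ e01; have [d02 u02] := merged _ _ e02.
  case: wsum => [w012|[i [j]]]; last first.
    suff e_all l : e l 0 by rewrite (trans_e _ _ _ (e_all i)) // sym_e e_all.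
    by move: l; apply: ord3P; rewrite ?refl_e // sym_e.
  suff d00 : d 0 = 0 by apply: ord3P; rewrite -?d01 -?d02.
  apply: (cancel_pole _ _ _ w012 (u0 0)).
  by rewrite -[RHS]sum0 -d01 -d02 -u01 -u02 -!mulrDl.
- by move: e12; rewrite (trans_e _ _ _ _ e02) // sym_e.
- by move: e02; rewrite (trans_e _ _ _ e01).
- have [d01 u01] := merged _ _ e01; have d20 : d 2 = 0 by rewrite d2 ?e02 ?e12.
  suff d00 : d 0 = 0 by apply: ord3P; rewrite -?d01.
  apply: (cancel_pole _ _ _ (wD 0 1 isT) (u0 0)).
  by rewrite -[RHS]sum0 -d01 -u01 d20 mulr0 mul0r addr0 -!mulrDl.
- by move: e01; rewrite (trans_e _ _ _ e02) // sym_e.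
- have [d02 u02] := merged _ _ e02.
  have d10 : d 1 = 0 by rewrite d1 ?e01 // sym_e e12.
  suff d00 : d 0 = 0 by apply: ord3P; rewrite -?d02.
  apply: (cancel_pole _ _ _ (wD 0 2 isT) (u0 0)).
  by rewrite -[RHS]sum0 -d02 -u02 d10 mulr0 mul0r addr0 -!mulrDl.
- have [d12 u12] := merged _ _ e12.
  have d00 : d 0 = 0 by rewrite d0 // sym_e ?e01 ?e02.
  suff d10 : d 1 = 0 by apply: ord3P; rewrite -?d12.
  apply: (cancel_pole _ _ _ (wD 1 2 isT) (u0 1)).
  by rewrite -[RHS]sum0 -d12 -u12 d00 mulr0 mul0r add0r -!mulrDl.
- by apply: ord3P; [apply: d0|apply: d1|apply: d2]; rewrite ?e01 ?e02 ?e12 //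
    sym_e ?e01 ?e02 ?e12.
Qed.

Variable R : realType.
Implicit Types (X : 'I_3 -> Cplx R -> Cplx R) (W : set (Cplx R * Cplx R)).

Lemma open_slices W (x t : Cplx R) : open W -> W (x, t) ->
  (\forall y \near x, W (y, t)) /\ (\forall s \near t, W (x, s)).
Proof.
move=> oW Wxt; have : nbhs (x, t) W by exact: open_nbhs_nbhs.
case=> -[A B] [/= xA tB] AB.
by split; [apply: filterS xA => y Ay|apply: filterS tB => s Bs];
  apply: AB; split=> //=; exact: nbhs_singleton.
Qed.

(** Distinct values stay distinct by continuity. If the values agree, the difference quotient of f -
    g at t has a nonzero limit, so f - g cannot vanish at nearby points other than t. *)
Lemma near_neq_punctured (f g : Cplx R -> Cplx R) t :
  derivable f t 1 -> derivable g t 1 ->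
  f t != g t \/ 'D_1 f t != 'D_1 g t ->
  \forall s \near t^', f s != g s.
Proof.
move=> df dg fg; have dh : derivable (f - g) t 1 by exact: derivableB.
suff : \forall s \near t^', (f - g) s != 0.
  by apply: filterS => s; rewrite subr_eq0.
have [fgt|fgt] := eqVneq ((f - g) t) 0; last first.
  have ch : {for t, continuous (f - g)}.
    exact/differentiable_continuous/derivable1_diffP.
  exact: nbhs_dnbhs (cvgr_neq0 _ ch fgt).
have Dh0 : 'D_1 (f - g) t != 0.
  rewrite deriveB // subr_eq0; case: fg => // /eqP[].
  by apply/eqP; rewrite -subr_eq0; apply/eqP.
have [r /= r0 quot_r] := cvgr_neq0 _ dh Dh0.
exists r => //= s ts st; apply: contraTneq (quot_r (s - t) _ _) => [fgs||].
- by rewrite /= [_%:A]mulr1 subrK fgs fgt subrr scaler0 eqxx.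
- by rewrite /= sub0r opprB.
- by rewrite subr_eq0.
Qed.

Lemma cvg_Qpol a b c X (i : 'I_3) t : (forall j, derivable (X j) t 1) ->
  Qpol a b c X (X i s) s @[s --> t^'] --> Qpol a b c X (X i t) t.
Proof.
move=> dX; have cX j : X j s @[s --> t^'] --> X j t.
  apply: cvg_within_filter.
  exact/differentiable_continuous/derivable1_diffP.
have cXX : X i s ^+ 2 @[s --> t^'] --> X i t ^+ 2.
  by rewrite !expr2; exact: cvgM.
have cXB e j k : e * (X j s - X k s) ^+ 2 @[s --> t^'] -->
    e * (X j t - X k t) ^+ 2.
  have cB : X j s - X k s @[s --> t^'] --> X j t - X k t.
    exact: cvgB (cX j) (cX k).
  rewrite !expr2; exact: cvgM (cvg_cst e) (cvgM cB cB).
exact: cvgD (cvgD (cvgD cXX (cXB a 0 1)) (cXB b 1 2)) (cXB c 2 0).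
Qed.

(** This treats both coefficients at once: weights 1 with simple poles for the scalar part, weights
    c_j with double poles for the [S] part. The conditions on [w] ensure that every class of merged
    poles that can occur has nonzero total weight. *)
Lemma halphen2_of_residues a b c X W (w : 'I_3 -> Cplx R) n :
  open W ->
  (forall x t, W (x, t) -> forall j, x != X j t) ->
  (forall x t, W (x, t) -> forall j, derivable (X j) t 1) ->
  (forall j, w j != 0) -> (forall i j, i != j -> w i + w j != 0) ->
  w 0 + w 1 + w 2 != 0 \/
    (forall x t, W (x, t) -> exists i j, X i t != X j t) ->
  (forall x t, W (x, t) ->
     \sum_j w j * ('D_1 (X j) t - Qpol a b c X (X j t) t) /
       (x - X j t) ^+ n.+1 = 0) ->
  forall x t, W (x, t) -> halphen2_at a b c X t.
Proof.
move=> oW nonsing derX w0 wD wsum res x t Wxt.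
pose d j s := 'D_1 (X j) s - Qpol a b c X (X j s) s.
have simple_pole s i : W (x, s) -> (forall j, j != i -> X j s != X i s) ->
    d i s = 0.
  move=> Wxs Xi; suff /eqP : w i * d i s = 0.
    by rewrite mulf_eq0 (negPf (w0 i)) => /eqP.
  apply: (@partial_fractions_eq0 _ _ n (fun j => w j * d j s)
    (fun j => X j s) x) => //.
  apply: filterS (open_slices oW Wxs).1 => y Wys.
  by split; [exact: nonsing|exact: res].
have escaping_pole i : (forall j, j != i ->
    X j t != X i t \/ 'D_1 (X j) t != 'D_1 (X i) t) -> d i t = 0.
  move=> Xi; apply/eqP; rewrite subr_eq0; apply/eqP.
  apply: (@derive_limit _ (X i) (fun s => Qpol a b c X (X i s) s) t).
  - exact/derivableP/(derX _ _ Wxt).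
  - have nW : \forall s \near t^', W (x, s).
      exact: nbhs_dnbhs (open_slices oW Wxt).2.
    (* No other node agrees with node [i] to first order at [t], so pole [i] is isolated from the
       others at nearby times other than [t]. *)
    have nX : \forall s \near t^', forall j, j != i -> X j s != X i s.
      apply: filter_forall => j; have [->|ji] := eqVneq j i.
        by apply: filterE => s /eqP.
      have := near_neq_punctured (derX _ _ Wxt j) (derX _ _ Wxt i) (Xi j ji).
      by apply: filterS.
    apply: filterS2 nW nX => s Wxs Xs.
    have /eqP := simple_pole s i Wxs Xs; rewrite subr_eq0 => /eqP <-.
    exact/derivableP/(derX _ _ Wxs).
  - exact/cvg_Qpol/(derX _ _ Wxt).
suff d0 j : d j t = 0.
  move=> j; have /eqP := d0 j; rewrite subr_eq0 => /eqP <-.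
  exact/derivableP/(derX _ _ Wxt).
pose e i j := (X i t == X j t) && ('D_1 (X i) t == 'D_1 (X j) t).
apply: (@merged_residues_eq0 _ w (d^~ t) (fun i => (x - X i t) ^+ n.+1) e).
- by move=> i; rewrite /e !eqxx.
- by move=> i i'; apply/idP/idP => /andP[/eqP Xii /eqP Dii];
    rewrite /e Xii Dii !eqxx.
- move=> i2 i1 i3 /andP[/eqP X12 /eqP D12] /andP[/eqP X23 /eqP D23].
  by rewrite /e X12 X23 D12 D23 !eqxx.
- by move=> i i' /andP[/eqP Xii /eqP Dii]; rewrite /d Xii Dii.
- move=> i ei; apply: escaping_pole => i' /ei; rewrite /e negb_and.
  by move/orP.
- exact: wD.
- case: wsum => [|/(_ _ _ Wxt) [i [i' ii]]]; [by left|right; exists i, i'].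
  by rewrite /e negb_and ii.
- by move=> i; rewrite expf_neq0 // subr_eq0 nonsing.
- exact: res.
Qed.

End CollidingNodes.

(** * Compatibility of the linear system and Halphen's second equation *)

(** The nondegeneracy disjunction matters when mu = 0: the condition is then void for S = 0, puts no
    constraint on x_j if c_j = 0, and holds automatically if all x_j coincide identically, since the
    c_j sum to zero. *)
Theorem theorem3 (R : realType) (a b c mu : Cplx R) (k : 'I_3 -> Cplx R)
  (S : 'M[Cplx R]_2) (X : 'I_3 -> Cplx R -> Cplx R)
  (nu : Cplx R -> Cplx R -> Cplx R) (W : set (Cplx R * Cplx R))
  (sum_k : k 0 + k 1 + k 2 = 0)
  (trS : \tr S = 0)
  (openW : open W)
  (nonsing : forall x t, W (x, t) -> forall j : 'I_3, x != X j t)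
  (derX : forall x t, W (x, t) -> forall j : 'I_3, derivable (X j) t 1)
  (dnu : forall x t, W (x, t) ->
     is_derive x 1 (fun z => nu z t)
       (- ((x + X 0 t + X 1 t + X 2 t) / Ppol X x t) * mu)) :
  ((mu != 0 \/
    [/\ S != 0, forall j : 'I_3, k j != 0 &
        forall x t, W (x, t) -> exists i j : 'I_3, X i t != X j t]) ->
   (forall x t, W (x, t) ->
      compatible_at (lax_A mu k S X) (lax_B a b c mu k S nu X) x t) ->
   forall x t, W (x, t) -> halphen2_at a b c X t)
  /\
  ((forall x t, W (x, t) -> halphen2_at a b c X t) ->
   forall x t, W (x, t) ->
     compatible_at (lax_A mu k S X) (lax_B a b c mu k S nu X) x t).
Proof.
have rates x t : W (x, t) -> forall j, is_derive t 1 (X j) ('D_1 (X j) t).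
  by move=> Wxt j; exact/derivableP/(derX _ _ Wxt).
split=> [nondeg compat | halphen x t Wxt]; last first.
  (* With D_j = Q(x_j) every residue is zero. *)
  apply/(compatible_atE a b c S sum_k (nonsing _ _ Wxt) (halphen _ _ Wxt)
    (dnu _ _ Wxt)).
  by rewrite !big_I3 /= !subrr !mulr0 !mul0r !addr0 mulr0 !scale0r addr0.
have residues x t (Wxt : W (x, t)) := (compatible_atE a b c S sum_k
  (nonsing _ _ Wxt) (rates _ _ Wxt) (dnu _ _ Wxt)).1 (compat _ _ Wxt).
have scalar_part x t (Wxt : W (x, t)) : mu / Ppol X x t *
    \sum_(j < 3) ('D_1 (X j) t - Qpol a b c X (X j t) t) / (x - X j t) = 0.
  (* The trace removes the [S] term, and the identity has trace 2, which is nonzero. *)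
  have := congr1 mxtrace (residues x t Wxt).
  rewrite mxtraceD !mxtraceZ trS mulr0 addr0 mxtrace1 mxtrace0 => /eqP.
  by rewrite mulf_eq0 pnatr_eq0 orbF => /eqP.
case: nondeg => [mu0|[S0 k0 noncoll]].
- apply: (@halphen2_of_residues _ _ _ _ X W (fun=> 1) 0) => //.
  + by left; have -> : 1 + 1 + 1 = 3%:R :> Cplx R by ring; rewrite pnatr_eq0.
  + move=> x t Wxt; have /eqP := scalar_part x t Wxt.
    have P0 : Ppol X x t != 0.
      by apply/prodf_neq0 => j _; rewrite subr_eq0 nonsing.
    rewrite !mulf_eq0 (negPf mu0) invr_eq0 (negPf P0) /= => /eqP sum0.
    by rewrite -[RHS]sum0; apply: eq_bigr => j _; rewrite mul1r expr1.
- apply: (@halphen2_of_residues _ _ _ _ X W k 1) => //.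
  (* Two of the c_j sum to minus the third, which is nonzero. *)
  + have kD (p q r : Cplx R) : r != 0 -> p + q + r = 0 -> p + q != 0.
      by move=> r0 /eqP; rewrite addr_eq0 => /eqP ->; rewrite oppr_eq0.
    apply: ord3P; apply: ord3P => // _.
    * by apply: (kD _ _ (k 2)); rewrite // -[RHS]sum_k; ring.
    * by apply: (kD _ _ (k 1)); rewrite // -[RHS]sum_k; ring.
    * by apply: (kD _ _ (k 2)); rewrite // -[RHS]sum_k; ring.
    * by apply: (kD _ _ (k 0)); rewrite // -[RHS]sum_k; ring.
    * by apply: (kD _ _ (k 1)); rewrite // -[RHS]sum_k; ring.
    * by apply: (kD _ _ (k 0)); rewrite // -[RHS]sum_k; ring.
  + by right.
  + move=> x t Wxt; have := residues x t Wxt.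
    rewrite scalar_part // scale0r add0r => /eqP.
    by rewrite scaler_eq0 (negPf S0) orbF => /eqP.
Qed.
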